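(* Let $d\ge 2$ be an integer, let $S_1,S_2$ be two $d$-ary trees, and let $\mathcal{F}(S_1;S_2)$ be the $d$-ary tree formed by appending a copy of $S_2$ to every leaf of $S_1$ (identifying the root of the copy of $S_2$ with that leaf). Then $$i_d\big(\mathcal{F}(S_1;S_2)\big)\ \ge\ \frac{(|S_1|\cdot|S_2|)!}{(|S_2|!)^{|S_1|}\cdot |S_1|^{|S_1|\cdot|S_2|}}\cdot \big(i_d(S_2)\big)^{|S_1|}.$$
   Context: All trees are finite and rooted, with unordered children; isomorphism means isomorphism of rooted trees. The single vertex is regarded as a tree whose only vertex is both root and leaf. For a rooted tree $T$, $|T|$ denotes its number of leaves. For an integer $d\ge 2$, a $d$-ary tree is a rooted tree in which every non-leaf vertex has between $2$ and $d$ children; it is strictly $d$-ary if every non-leaf vertex has exactly $d$ children. (An $n$-leaf strictly $d$-ary tree exists iff $n\ge 1$ and $n\equiv 1 \bmod (d-1)$.) For a nonempty set $S$ of leaves of $T$, the subtree of $T$ induced by $S$ is obtained by taking the minimal subtree of $T$ containing the leaves in $S$, rooting it at the most recent common ancestor of $S$, and suppressing (contracting) all non-root vertices of degree $2$. Let $c(D,T)$ be the number of sets of $|D|$ leaves of $T$ whose induced subtree is isomorphic to $D$, and for $|T|\ge |D|$ let $\gamma(D,T)=c(D,T)/\binom{|T|}{|D|}$. The inducibility of a $d$-ary tree $D$ in strictly $d$-ary trees is $$i_d(D)=\limsup_{n\to\infty}\ \max_{|T|=n,\ T\text{ strictly }d\text{-ary}}\gamma(D,T),$$ where $n$ ranges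 over integers $n\equiv 1 \bmod (d-1)$. *)

(* Defs.v *)
From mathcomp Require Import all_boot all_order all_algebra finmap.
From mathcomp Require Import all_classical all_reals all_analysis.

Set Implicit Arguments.
Unset Strict Implicit.
Unset Printing Implicit Defensive.

Import Order.TTheory GRing.Theory Num.Theory.

(* A finite rooted tree, given by the list of subtrees at the children of its
   root.  The order of the children carries no information: trees are only
   ever compared up to [tree_iso].  A vertex is a leaf iff it has no child, so
   the single vertex is [Node [::]]. *)
Inductive tree : Type := Node of seq tree.

Definition children (t : tree) : seq tree := let: Node ts := t in ts.

(* Isomorphism of rooted trees: the children [ts] of the second root can be
   rearranged so that they are pairwise isomorphic to the children of the
   first one.  The rearrangements of [ts] are indexed by the permutations of
   its positions. *)
Fixpoint tree_iso (s t : tree) : bool :=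
  let: Node ss := s in
  let: Node ts := t in
  has (fun p => all2 tree_iso ss [seq nth (Node [::]) ts i | i <- p])
      (permutations (iota 0 (size ts))).

Fixpoint d_ary (d : nat) (t : tree) : bool :=
  let: Node ts := t in
  (nilp ts || (2 <= size ts <= d)) && all (d_ary d) ts.

Fixpoint strictly_d_ary (d : nat) (t : tree) : bool :=
  let: Node ts := t in
  (nilp ts || (size ts == d)) && all (strictly_d_ary d) ts.

Definition mapi (A B : Type) (f : nat -> A -> B) : nat -> seq A -> seq B :=
  fix loop i s := if s is x :: s' then f i x :: loop i.+1 s' else [::].

(* A vertex is identified by its address, the list of the positions of the
   children chosen on the path leading to it from the root. *)
Fixpoint leaves (t : tree) : seq (seq nat) :=
  let: Node ts := t in
  if nilp ts then [:: [::]]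
  else flatten (mapi (fun i u => [seq i :: a | a <- leaves u]) 0 ts).

Definition nleaves (t : tree) : nat := size (leaves t).

(* The union of the paths from the root of t to the leaves whose address
   satisfies P, i.e. t restricted to the vertices having such a leaf below or
   equal to them (meaningful only if there is at least one such leaf). *)
Fixpoint prune (P : pred (seq nat)) (t : tree) : tree :=
  let: Node ts := t in
  Node (flatten (mapi (fun i u =>
    if has (fun a => P (i :: a)) (leaves u)
    then [:: prune (fun a => P (i :: a)) u] else [::]) 0 ts)).

(* Moves the root down to the first vertex that does not have exactly one
   child; on the union of the paths from the root to the leaves of S, that
   vertex is the most recent common ancestor of S. *)
Fixpoint reroot (t : tree) : tree :=
  if t is Node [:: u] then reroot u else t.

(* A non-root vertex has degree 2 iff it has exactly one child. *)
Fixpoint suppress_below (t : tree) : tree :=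
  match t with
  | Node [:: u] => suppress_below u
  | Node ts => Node (map suppress_below ts)
  end.

Definition suppress (t : tree) : tree :=
  Node (map suppress_below (children t)).

Definition induced (S : {fset seq nat}) (T : tree) : tree :=
  suppress (reroot (prune (fun a => a \in S) T)).

Definition leaf_set (T : tree) : {fset seq nat} := [fset a in leaves T]%fset.

Definition copies (D T : tree) : nat :=
  #|` [fset S in fpowerset (leaf_set T) |
         (#|` S| == nleaves D) && tree_iso (induced S T) D]%fset |.

Fixpoint append_tree (S1 S2 : tree) : tree :=
  let: Node ts := S1 in
  if nilp ts then S2 else Node (map (fun u => append_tree u S2) ts).

Local Open Scope ring_scope.
Local Open Scope classical_set_scope.

Definition density (R : realType) (D T : tree) : R :=
  (copies D T)%:R / ('C(nleaves T, nleaves D))%:R.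

(* The supremum is a maximum: for n = 1 mod d - 1 the set is nonempty, and it
   is finite since the density takes finitely many values for each n. *)
Definition max_density (R : realType) (d : nat) (D : tree) (n : nat) : R :=
  sup [set density R D T | T in
         [set T : tree | strictly_d_ary d T /\ nleaves T = n]].

(* The integers n = 1 mod d - 1, n >= 1, are enumerated increasingly as
   k * (d - 1) + 1.  The densities for the finitely many n < |D| are junk (0)
   and do not affect the limsup. *)
Definition inducibility (R : realType) (d : nat) (D : tree) : R :=
  limn_sup (fun k : nat => max_density R d D (k * d.-1 + 1)%N).

(* Main.v *)
(* Let m = |S1| and s = |S2|.  Add leaves to the internal vertices of [S1] so
   that it becomes strictly d-ary, and append a strictly d-ary tree T with
   n >= s leaves, nearly optimal for [S2], at the m original leaves.  The result
   has N = m n + e leaves with e independent of T, and choosing one copy of [S2]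
   in each of the m copies of T gives distinct copies of F(S1; S2), hence at
   least c(S2, T)^m of them.  Moreover
     C(n, s)^m / C(N, m s) >= (m s)! / (s!^m m^(m s)) (m (n - s) / N)^(m s),
   whose last factor tends to 1. *)
Require Import Defs.
From mathcomp Require Import all_boot all_order all_algebra finmap.
From mathcomp Require Import all_classical all_reals all_analysis.
From mathcomp Require Import zify ring.

Set Implicit Arguments.
Unset Strict Implicit.
Unset Printing Implicit Defensive.

Import Order.TTheory GRing.Theory Num.Theory.

(** * Trees and leaf addresses *)

(** Writing the hypothesis on the children as a [foldr] of conjunctions lets it unfold along inner
    inductions on the list of children. *)
Lemma tree_ind_children (P : tree -> Prop) :
  (forall ts, foldr (fun t => and (P t)) True ts -> P (Node ts)) ->
  forall t, P t.
Proof.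
move=> PNode; fix IH 1; case=> ts; apply: PNode.
by elim: ts => //= t ts; exact: conj (IH t).
Qed.

Lemma mapiS (A B : Type) (f : nat -> A -> B) i s :
  mapi f i.+1 s = mapi (fun k => f k.+1) i s.
Proof. by elim: s i => //= x s IHs i; rewrite IHs. Qed.

Section Addresses.
Variables (A : Type) (f : A -> seq (seq nat)).

(** Kept abstract in [f] to cover both the leaves below a vertex ([f := leaves]) and the union of
    leaf sets of its children ([f := @enum_fset _]). *)
Definition addresses i s :=
  flatten (mapi (fun i x => [seq i :: a | a <- f x]) i s).

Lemma mem_addresses i s b :
  (b \in addresses i s) =
    if b is k :: a then (i <= k) && (a \in nth [::] (map f s) (k - i))
    else false.
Proof.
rewrite /addresses; elim: s i => [|x s IHs] i /=.
  by case: b => [|k a] //; rewrite nth_nil andbF.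
rewrite mem_cat {}IHs; case: b => [|k a].
  by rewrite orbF; apply/mapP => -[].
have -> : (k :: a \in [seq i :: a0 | a0 <- f x]) = (k == i) && (a \in f x).
  apply/mapP/andP => [[b bx [-> ->]]|[/eqP-> ax]]; first by rewrite eqxx.
  by exists a.
case: (ltngtP i k) => [ik|ik|->] /=; rewrite ?subnn ?orbF //.
by rewrite subnS -subnSK.
Qed.

Lemma uniq_addresses i s :
  foldr (fun x => and (uniq (f x))) True s -> uniq (addresses i s).
Proof.
rewrite /addresses; elim: s i => //= x s IHs i [ux us].
rewrite cat_uniq IHs // andbT map_inj_uniq ?ux => [|a b [] //].
apply/hasPn => b; rewrite -/(addresses _ _) mem_addresses; case: b => // k a.
by move=> /andP[ik _]; apply/mapP => -[b _ [ki _]]; rewrite ki ltnn in ik.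
Qed.

Lemma size_addresses i s :
  size (addresses i s) = sumn [seq size (f x) | x <- s].
Proof.
by rewrite /addresses; elim: s i => //= x s IHs i; rewrite size_cat size_map IHs.
Qed.

End Addresses.

Lemma leaves_Node ts :
  leaves (Node ts) = if nilp ts then [:: [::]] else addresses leaves 0 ts.
Proof. by []. Qed.

Lemma nleaves_Node ts :
  nleaves (Node ts) = if nilp ts then 1 else sumn (map nleaves ts).
Proof.
by rewrite /nleaves leaves_Node; case: nilP => // _; rewrite size_addresses.
Qed.

Lemma nleaves_gt0 t : 0 < nleaves t.
Proof.
elim/tree_ind_children: t => -[//|t ts] /= [t_gt0 _].
by rewrite nleaves_Node /= addn_gt0 t_gt0.
Qed.

Lemma uniq_leaves t : uniq (leaves t).
Proof.
elim/tree_ind_children: t => ts IH; rewrite leaves_Node.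
by case: nilP => // _; apply: uniq_addresses.
Qed.

Lemma card_leaf_set t : #|` leaf_set t| = nleaves t.
Proof. by rewrite card_fseq undup_id // uniq_leaves. Qed.

(** * Copies as sets of leaves *)

(** Its cardinality is [copies D T] by conversion. *)
Definition copy_sets (D T : tree) : {fset {fset seq nat}} :=
  [fset S in fpowerset (leaf_set T) |
    (#|` S| == nleaves D) && tree_iso (Defs.induced S T) D]%fset.

Lemma mem_copy_sets (D T : tree) S :
  (S \in copy_sets D T) =
  [&& (S `<=` leaf_set T)%fset, #|` S| == nleaves D
    & tree_iso (Defs.induced S T) D].
Proof. by rewrite !inE /= fpowersetE. Qed.

(** Restricting subsets to the finite type of elements of [A] is injective and preserves
    cardinality, so [card_draws] applies. *)
Lemma card_subsets_fset (K : choiceType) (A : {fset K}) (P : pred {fset K}) n :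
  #|` [fset S in fpowerset A | (#|` S| == n) && P S]%fset| <= 'C(#|` A|, n).
Proof.
rewrite [X in 'C(X, _)]cardfE -card_draws cardfE.
rewrite -(card_in_imset (f := fun S => fsub A (val S))).
  apply/subset_leq_card/fintype.subsetP => _ /imsetP[S _ ->].
  have := valP S; rewrite !inE fpowersetE => /andP[SA /andP[szS _]].
  by rewrite card_fsub.
move=> S S' _ _ /fsub_inj eqSS'; apply/val_inj/eqSS'; rewrite inE.
  by have := valP S; rewrite !inE fpowersetE => /andP[].
by have := valP S'; rewrite !inE fpowersetE => /andP[].
Qed.

Lemma copies_le_bin D T : copies D T <= 'C(nleaves T, nleaves D).
Proof. by rewrite -(card_leaf_set T); exact: card_subsets_fset. Qed.

(** * Subtrees induced by glued leaf sets *)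

Lemma tree_iso_children ss ts :
  all2 tree_iso ss ts -> tree_iso (Node ss) (Node ts).
Proof.
move=> iso; apply/hasP; exists (iota 0 (size ts)).
  by rewrite mem_permutations perm_refl.
by rewrite map_nth_iota0 // take_size.
Qed.

(** Both sides first skip the chain of single-child vertices at the root. Hence contracting below a
    child yields the induced subtree inside that child. *)
Lemma suppress_below_reroot t : suppress_below t = suppress (reroot t).
Proof. by elim/tree_ind_children: t => -[|t [|t' ts]] //= [-> _]. Qed.

Lemma prune_mapi_pred0 (P : nat -> pred (seq nat)) i us :
  (forall i, P i =1 pred0) ->
  flatten (mapi (fun i u =>
    if has (P i) (leaves u) then [:: prune (P i) u] else [::]) i us) = [::].
Proof.
by move=> P0; elim: us i => //= u us IH i; rewrite (eq_has (P0 i)) has_pred0 IH.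
Qed.

(** Children beyond [Ss] get the default [fset0] and vanish; the others survive because their sets
    are nonempty. *)
Lemma prune_mapi (Ss : seq {fset seq nat}) us : size Ss <= size us ->
  all2 (fun S u => (S != fset0) && (S `<=` leaf_set u)%fset) Ss
    (take (size Ss) us) ->
  flatten (mapi (fun i u =>
    if has (fun a => a \in nth fset0 Ss i) (leaves u)
    then [:: prune (fun a => a \in nth fset0 Ss i) u] else [::]) 0 us) =
  [seq prune (fun a => a \in p.1) p.2 | p <- zip Ss us].
Proof.
elim: us Ss => [|u us IH] [|S Ss] //= szS.
  move=> _; apply: (prune_mapi_pred0 (P := fun i a => a \in nth fset0 [::] i)
    0 (u :: us)) => i a.
  by rewrite nth_nil inE.
case/andP=> /andP[/fset0Pn[a aS] /fsubsetP/(_ a aS)]; rewrite inE /= => au H.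
by rewrite mapiS /= IH // (_ : has _ _) //; apply/hasP; exists a.
Qed.

(* [Ss]`_i is meant as a set of leaves of the i-th child of a vertex. *)
Definition glue (Ss : seq {fset seq nat}) : {fset seq nat} :=
  [fset a in addresses (@enum_fset _) 0 Ss]%fset.

Lemma mem_glue Ss b :
  (b \in glue Ss) = if b is i :: a then a \in nth fset0 Ss i else false.
Proof.
rewrite inE /= mem_addresses; case: b => // i a; rewrite subn0 leq0n /=.
have [lt_i|ge_i] := ltnP i (size Ss); first by rewrite (nth_map fset0).
by rewrite !nth_default ?size_map // inE.
Qed.

Lemma card_glue Ss : #|` glue Ss| = sumn [seq #|` A| | A <- Ss].
Proof.
rewrite card_fseq undup_id ?size_addresses //.
by apply: uniq_addresses; elim: Ss => //= A Ss; split; first exact: fset_uniq.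
Qed.

Lemma glue_inj Ss Ss' : size Ss = size Ss' -> glue Ss = glue Ss' -> Ss = Ss'.
Proof.
move=> sz eqg; apply: (eq_from_nth (x0 := fset0)) => // i _.
by apply/fsetP => a; have := mem_glue Ss (i :: a); rewrite eqg mem_glue.
Qed.

(** At least two children survive pruning, so [reroot] stops at the root and only the parts below
    the children get contracted. *)
Lemma induced_glue Ss us : 1 < size Ss -> size Ss <= size us ->
  all2 (fun S u => (S != fset0) && (S `<=` leaf_set u)%fset) Ss
    (take (size Ss) us) ->
  Defs.induced (glue Ss) (Node us) =
    Node [seq Defs.induced p.1 p.2 | p <- zip Ss us].
Proof.
move=> Ss_gt1 szS sub.
rewrite /Defs.induced; have -> : prune (fun a => a \in glue Ss) (Node us) =
          Node [seq prune (fun a => a \in p.1) p.2 | p <- zip Ss us].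
  rewrite -prune_mapi //; congr Node; congr (flatten (mapi _ 0 us)).
  apply/funext => i; apply/funext => u.
  by have -> : (fun a => i :: a \in glue Ss) = (fun a => a \in nth fset0 Ss i)
    by apply/funext => a; rewrite mem_glue.
rewrite /suppress.
case: Ss us Ss_gt1 szS {sub} => [|S [|S' Ss]] // [|u [|u' us]] //= _ _.
rewrite !suppress_below_reroot; congr (Node [:: _, _ & _]).
by rewrite -map_comp; apply: eq_map => p; rewrite /= suppress_below_reroot.
Qed.

(** * Choosing one copy below each child *)

(** The Cartesian product of the lists in [Ls]. *)
Definition selections (T : eqType) (Ls : seq (seq T)) : seq (seq T) :=
  foldr (fun L acc => [seq x :: s | x <- L, s <- acc]) [:: [::]] Ls.

Lemma mem_selections (T : eqType) (Ls : seq (seq T)) s :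
  (s \in selections Ls) = all2 (fun x (L : seq T) => x \in L) s Ls.
Proof.
elim: Ls s => [|L Ls IHs] [|x s] //=.
  by apply/allpairsP => -[[? ?] /= [_ _]].
rewrite -IHs; apply/allpairsP/andP => [[[y s'] /= [yL s'Ls [-> ->]]]|[xL sLs]].
  by [].
by exists (x, s).
Qed.

Lemma size_selections (T : eqType) (Ls : seq (seq T)) :
  size (selections Ls) = \prod_(L <- Ls) size L.
Proof.
by elim: Ls => [|L Ls IH]; rewrite ?big_nil ?big_cons //= size_allpairs IH.
Qed.

Lemma uniq_selections (T : eqType) (Ls : seq (seq T)) :
  all uniq Ls -> uniq (selections Ls).
Proof.
elim: Ls => //= L Ls IH /andP[uL uLs]; apply: allpairs_uniq; rewrite ?IH //.
by move=> [x s] [y t] _ _ [-> ->].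
Qed.

Lemma glue_copies Ds us Ss : size Ds <= size us ->
  all2 (fun S (L : seq {fset seq nat}) => S \in L) Ss
    [seq enum_fset (copy_sets p.1 p.2) | p <- zip Ds us] ->
  [/\ size Ss = size Ds,
      all2 (fun S u => (S != fset0) && (S `<=` leaf_set u)%fset) Ss
        (take (size Ss) us),
      sumn [seq #|` A| | A <- Ss] = sumn [seq nleaves D | D <- Ds] &
      all2 tree_iso [seq Defs.induced p.1 p.2 | p <- zip Ss us] Ds].
Proof.
elim: Ds us Ss => [|D Ds IH] [|u us] [|S Ss] //= szD.
case/andP; rewrite -[_ \in _]/(S \in copy_sets D u) mem_copy_sets.
case/and3P=> subS /eqP szS isoS /IH-/(_ szD) [-> sub -> iso]; split=> //.
- by rewrite subS sub -cardfs_gt0 szS nleaves_gt0.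
- by rewrite szS.
- by apply/andP; split; first exact: isoS.
Qed.

Lemma all2_take_nth (A B : Type) (r : A -> B -> bool) x0 y0 s t i :
  all2 r s (take (size s) t) -> i < size s -> r (nth x0 s i) (nth y0 t i).
Proof.
elim: s t i => [|x s IHs] [|y t] [|i] //= /andP[rxy rst] //.
by rewrite ltnS; apply: IHs.
Qed.

(** Gluing maps selections of copies, one for each pair of [zip Ds us], injectively to copies of
    [Node Ds]. *)
Lemma copies_Node Ds us : 1 < size Ds -> size Ds <= size us ->
  \prod_(p <- zip Ds us) copies p.1 p.2 <= copies (Node Ds) (Node us).
Proof.
move=> Ds_gt1 szD.
pose Ls := [seq enum_fset (copy_sets p.1 p.2) | p <- zip Ds us].
have -> : \prod_(p <- zip Ds us) copies p.1 p.2 = size (map glue (selections Ls)).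
  by rewrite size_map size_selections big_map.
apply: uniq_leq_size.
  rewrite map_inj_in_uniq ?uniq_selections //.
    by rewrite /Ls; elim: (zip Ds us) => //= p ps ->; rewrite fset_uniq.
  move=> Ss Ss'; rewrite !mem_selections.
  move=> /(glue_copies szD)[szS _ _ _] /(glue_copies szD)[szS' _ _ _].
  by apply: glue_inj; rewrite szS szS'.
move=> _ /mapP[Ss + ->]; rewrite mem_selections => /(glue_copies szD).
case=> szS sub cardS iso; rewrite -[_ \in _]/(_ \in copy_sets _ _).
rewrite mem_copy_sets card_glue cardS nleaves_Node; apply/and3P; split.
- apply/fsubsetP => b; rewrite mem_glue inE leaves_Node.
  case: b => // i a aS; case: nilP (szD) => [->|_ _]; first by case: (Ds) Ds_gt1.
  rewrite mem_addresses leq0n subn0 /=.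
  have lt_iS : i < size Ss.
    by rewrite ltnNge; apply: contraL aS => ?; rewrite nth_default // inE.
  rewrite (nth_map (Node [::])) ?(leq_trans lt_iS) ?szS //.
  have /andP[_ /fsubsetP/(_ a aS)] := all2_take_nth fset0 (Node [::]) sub lt_iS.
  by rewrite inE.
- by case: (Ds) Ds_gt1.
- by rewrite (induced_glue _ _ sub) ?szS //; apply: tree_iso_children.
Qed.

(** * Appending trees at the leaves, with padding *)

(* Padding the internal vertices of [S] with leaves, rather than with copies of
   [T], keeps the number of extra leaves independent of [T]. *)
Fixpoint pad_append (d : nat) (S T : tree) : tree :=
  let: Node ts := S in
  if nilp ts then T
  else Node ([seq pad_append d u T | u <- ts] ++
             nseq (d - size ts) (Node [::])).

Lemma strictly_d_ary_pad_append d S T : d_ary d S -> strictly_d_ary d T ->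
  strictly_d_ary d (pad_append d S T).
Proof.
move=> dS dT; elim/tree_ind_children: S dS => ts IH /=.
case: nilP => //= ts0 /andP[/andP[ts_gt1 ts_le] dts].
rewrite size_cat size_map size_nseq subnKC // eqxx orbT all_cat all_nseq orbT.
rewrite andbT /=; elim: ts {ts0 ts_gt1 ts_le} IH dts => //= t ts IHs [IHt IHts].
by move=> /andP[/IHt-> /IHs->].
Qed.

(** A leaf of [S] gives equality; at an internal vertex [copies_Node] multiplies the bounds of the
    children, so the exponents add up to [nleaves S]. *)
Lemma copies_append_tree d S D T : d_ary d S ->
  copies D T ^ nleaves S <= copies (append_tree S D) (pad_append d S T).
Proof.
elim/tree_ind_children: S => ts IH /=.
rewrite nleaves_Node; case: nilP => //= ts0 /andP[/andP[ts_gt1 ts_le] dts].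
apply: leq_trans (copies_Node _ _); rewrite ?size_cat ?size_map ?leq_addr //.
(* The padding is generalised because its length depends on [ts]; [zip] pairs nothing with it. *)
move: (nseq _ _) => vs.
elim: ts {ts0 ts_gt1 ts_le} IH dts => [|t ts IHs] /=.
  by rewrite (_ : zip _ _ = [::]) ?big_nil //; case: vs.
by move=> [IHt IHts] /andP[dt dts]; rewrite big_cons expnD leq_mul ?IHt ?IHs.
Qed.

Lemma nleaves_append_tree S T : nleaves (append_tree S T) = nleaves S * nleaves T.
Proof.
elim/tree_ind_children: S => ts IH /=; rewrite nleaves_Node.
case: nilP => [_|ts0]; first by rewrite mul1n.
rewrite nleaves_Node; case: nilP => [|_]; first by case: (ts) ts0.
by elim: ts {ts0} IH => //= t ts IHs [-> /IHs->]; rewrite mulnDl.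
Qed.

Lemma nleaves_pad_append d S : exists e, forall T,
  nleaves (pad_append d S T) = nleaves S * nleaves T + e.
Proof.
elim/tree_ind_children: S => ts IH /=.
case: (boolP (nilp ts)) => [/nilP->|ts0].
  by exists 0 => T; rewrite nleaves_Node /= mul1n addn0.
have [e He] : exists e, forall T,
    sumn [seq nleaves (pad_append d u T) | u <- ts] =
    sumn [seq nleaves u | u <- ts] * nleaves T + e.
  elim: ts {ts0} IH => [|t ts IHs] /=; first by exists 0.
  move=> [[e1 He1] /IHs[e2 He2]]; exists (e1 + e2) => T.
  by rewrite He1 He2 mulnDl addnACA.
exists (e + (d - size ts)) => T; rewrite !nleaves_Node (negPf ts0).
case: nilP => [|_]; first by case: (ts) ts0.
by rewrite map_cat -map_comp sumn_cat He map_nseq sumn_nseq mul1n addnA.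
Qed.

(** The [d] children contribute remainders adding up to [d], that is, one more multiple of [d.-1]
    plus 1. This places the padded tree in the sequence defining [inducibility]. *)
Lemma nleaves_strictly_d_ary d T : 0 < d -> strictly_d_ary d T ->
  exists q, nleaves T = q * d.-1 + 1.
Proof.
move=> d_gt0; elim/tree_ind_children: T => ts IH /=; rewrite nleaves_Node.
case: nilP => [_ _|ts0 /= /andP[/eqP szts dts]]; first by exists 0.
have [q ->] : exists q, sumn (map nleaves ts) = q * d.-1 + size ts.
  elim: ts {ts0 szts} IH dts => [|t ts IHs] /=; first by exists 0.
  move=> [IHt IHts] /andP[/IHt[q1 ->] /IHs-/(_ IHts)[q2 ->]].
  by exists (q1 + q2); rewrite mulnDl; lia.
by exists q.+1; rewrite szts mulSn; lia.
Qed.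

(** * Binomial estimates *)

Lemma ffact_le_exp n k : n ^_ k <= n ^ k.
Proof.
rewrite ffact_prod -[X in _ <= _ ^ X]card_ord -prod_nat_const.
by apply: leq_prod => i _; apply: leq_subr.
Qed.

Lemma exp_le_ffact n k : (n - k) ^ k <= n ^_ k.
Proof.
rewrite ffact_prod -[X in _ ^ X <= _]card_ord -prod_nat_const.
by apply: leq_prod => i _; rewrite leq_sub2l // ltnW.
Qed.

(** The binomial ratio bound cleared of denominators: factorials times binomials are falling
    factorials, bounded above by [N ^ (m * s)] and below by powers of [n - s]. *)
Lemma bin_ratio_le n s m N :
  (m * s)`! * (n - s) ^ (m * s) * 'C(N, m * s) <=
  s`! ^ m * N ^ (m * s) * 'C(n, s) ^ m.
Proof.
rewrite mulnAC [_`! * _]mulnC bin_ffact mulnC [s`! ^ m * _]mulnC -mulnA -expnMn.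
rewrite [s`! * _]mulnC bin_ffact [X in X <= _]mulnC leq_mul ?ffact_le_exp //.
by rewrite mulnC expnM; case: m => // m; rewrite leq_exp2r // exp_le_ffact.
Qed.

(** * Suprema and densities *)

Local Open Scope ring_scope.
Local Open Scope classical_set_scope.
Import numFieldNormedType.Exports.

(** By continuity the solutions [x] of the inequality form a closed set, and [sup A] lies in the
    closure of [A]. *)
Lemma exp_sup_le (R : realType) (A : set R) (r M : R) m :
  (0 < m)%N -> 0 <= M -> has_ubound A ->
  (forall x, A x -> r * x ^+ m <= M) -> r * sup A ^+ m <= M.
Proof.
(* For empty [A] the supremum is 0, and [0 < m] and [0 <= M] settle the claim. *)
move=> m_gt0 M_ge0 ubA leM; have [->|/set0P A0] := eqVneq A set0.
  by rewrite sup0 expr0n gtn_eqF // mulr0.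
have : closed [set x | r * x ^+ m <= M].
  apply: (@preimage_closed _ _ (fun x : R => r * x ^+ m)
    [set y | y <= M]) => [x _|].
    by apply: cvgMr; apply: exprn_continuous.
  exact: closed_le.
rewrite closure_id => clE; suff: [set x | r * x ^+ m <= M] (sup A) by [].
by rewrite clE; apply: (closure_subset leM); apply: closure_sup.
Qed.

Section Density.
Variable R : realType.
Implicit Types D T : tree.

Lemma density_ge0 D T : 0 <= density R D T.
Proof. by rewrite divr_ge0. Qed.

Lemma density_le1 D T : density R D T <= 1.
Proof.
rewrite /density; have [->|C0] := posnP ('C(nleaves T, nleaves D)).
  by rewrite invr0 mulr0.
by rewrite ler_pdivrMr ?ltr0n // mul1r ler_nat copies_le_bin.
Qed.

Lemma ubound_density d D n :
  ubound [set density R D T | T in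
    [set T : tree | strictly_d_ary d T /\ nleaves T = n]] 1.
Proof. by move=> _ [T _ <-]; exact: density_le1. Qed.

Lemma density_le_max d D T : strictly_d_ary d T ->
  density R D T <= max_density R d D (nleaves T).
Proof.
move=> dT; apply: ub_le_sup; first by exists 1; exact: ubound_density.
by exists T.
Qed.

Lemma max_density_ge0 d D n : 0 <= max_density R d D n.
Proof.
rewrite /max_density; set A := (X in sup X).
have [->|/set0P[x Ax]] := eqVneq A set0; first by rewrite sup0.
apply: (@le_trans _ _ x); first by case: Ax => T _ <-; exact: density_ge0.
by apply: ub_le_sup => //; exists 1; exact: ubound_density.
Qed.

Lemma max_density_le1 d D n : max_density R d D n <= 1.
Proof.
rewrite /max_density; set A := (X in sup X).
have [->|/set0P A0] := eqVneq A set0; first by rewrite sup0.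
by apply: ge_sup => //; exact: ubound_density.
Qed.

(** The error factor depends on [k] but not on [T], so suprema over all [T] with more than [k]
    leaves can be taken afterwards. *)
Lemma density_pad_append d S D T e k :
  d_ary d S ->
  (nleaves (pad_append d S T) = nleaves S * nleaves T + e)%N ->
  (k < nleaves T)%N -> (nleaves S * nleaves D + e <= k)%N ->
  ((nleaves S * nleaves D)`!)%:R
      / (((nleaves D)`!)%:R ^+ nleaves S
         * (nleaves S)%:R ^+ (nleaves S * nleaves D))
   * (1 - (nleaves S * nleaves D + e)%:R * k.+1%:R^-1)
       ^+ (nleaves S * nleaves D) * density R D T ^+ nleaves S <=
  density R (append_tree S D) (pad_append d S T).
Proof.
move=> dS nN kn ck; rewrite /density nN nleaves_append_tree.
have := copies_append_tree D T dS; have m_gt0 := nleaves_gt0 S.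
move: (copies D T) (copies (append_tree _ _) _) => c1 c2.
move: (nleaves T) (nleaves S) (nleaves D) m_gt0 kn ck {nN dS}.
move=> n m s m_gt0 kn ck c12.
have sn : (s <= n)%N by nia.
set N := (m * n + e)%N; set x := 1 - _.
have N_gt0 : (k < N)%N by rewrite /N; nia.
have CN_gt0 : (0 < 'C(N, m * s))%N by rewrite bin_gt0 /N; nia.
have Cn_gt0 : (0 < 'C(n, s))%N by rewrite bin_gt0.
have x_ge0 : 0 <= x.
  by rewrite subr_ge0 ler_pdivrMr ?ltr0n // mul1r ler_nat ltnW // ltnS.
(* The right side is [N - (m * s + e)], and [k.+1 <= N] makes the term subtracted in [x * N] at
   least [m * s + e]. *)
have xN : x * N%:R <= (m * (n - s))%:R.
  have -> : (m * (n - s))%:R = N%:R - (m * s + e)%:R :> R.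
    by rewrite -natrB; [congr _%:R; rewrite /N; nia | rewrite /N; nia].
  rewrite /x mulrBl mul1r lerD2l lerN2 -mulrA ler_peMr // ler_pdivlMl ?ltr0n //.
  by rewrite mulr1 ler_nat.
rewrite ler_pdivlMr ?ltr0n //; apply: le_trans (_ : c1%:R ^+ m <= _); last first.
  by rewrite -natrX ler_nat.
rewrite expr_div_n; set C := _%:R / _.
rewrite [X in X <= _](_ : _ =
  C * x ^+ (m * s) * 'C(N, m * s)%:R / 'C(n, s)%:R ^+ m * c1%:R ^+ m); last by ring.
(* It remains to bound the coefficient of [c1 ^+ m] by 1. *)
rewrite ler_piMl ?exprn_ge0 // ler_pdivrMr ?exprn_gt0 ?ltr0n // mul1r.
have NX : 0 < N%:R ^+ (m * s) :> R by rewrite exprn_gt0 // ltr0n; lia.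
have mX : 0 < m%:R ^+ (m * s) :> R by rewrite exprn_gt0 // ltr0n.
have sX : 0 < s`!%:R ^+ m :> R by rewrite exprn_gt0 // ltr0n fact_gt0.
have C_ge0 : 0 <= C by rewrite divr_ge0 // mulr_ge0 // ltW.
rewrite -(ler_pM2r NX) -(ler_pM2l sX).
have := bin_ratio_le n s m N; rewrite -(ler_nat R) !natrM !natrX.
have xNX : x ^+ (m * s) * N%:R ^+ (m * s) <= (m%:R * (n - s)%:R) ^+ (m * s).
  rewrite -exprMn -natrM; apply: lerXn2r; rewrite ?nnegrE ?mulr_ge0 //.
rewrite exprMn in xNX; move=> leN.
rewrite [X in _ <= X](_ : _ = s`!%:R ^+ m * N%:R ^+ (m * s) *
  'C(n, s)%:R ^+ m); last by ring.
apply: le_trans leN; rewrite [X in X <= _](_ : _ =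
  (m * s)`!%:R / m%:R ^+ (m * s) * 'C(N, m * s)%:R *
  (x ^+ (m * s) * N%:R ^+ (m * s))); last first.
  by rewrite /C; field; rewrite !gt_eqF.
apply: le_trans (ler_wpM2l _ xNX) _; first by rewrite mulr_ge0 // divr_ge0 // ltW.
by rewrite le_eqVlt; apply/orP; left; apply/eqP; field; rewrite gt_eqF.
Qed.

End Density.

(** * Passage to the limit superior *)

(** Tail suprema of a sequence with values between 0 and 1 converge to their infimum. *)
Lemma cvg_sups_max_density (R : realType) d D :
  sups (fun k => max_density R d D (k * d.-1 + 1)) @ \oo --> inducibility R d D.
Proof.
rewrite /inducibility /limn_sup.
suff : cvgn (sups (fun k => max_density R d D (k * d.-1 + 1))) by [].
apply: cvgP; apply: cvg_sups_inf.
  by exists 1 => _ [k _ <-]; exact: max_density_le1.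
by exists 0 => _ [k _ <-]; exact: max_density_ge0.
Qed.

Lemma sups_max_density_append_tree (R : realType) d S D :
  (2 <= d)%N -> d_ary d S -> exists e, forall k,
  (nleaves S * nleaves D + e <= k)%N ->
  ((nleaves S * nleaves D)`!)%:R
      / (((nleaves D)`!)%:R ^+ nleaves S
         * (nleaves S)%:R ^+ (nleaves S * nleaves D))
   * (1 - (nleaves S * nleaves D + e)%:R * k.+1%:R^-1)
       ^+ (nleaves S * nleaves D)
   * sups (fun k => max_density R d D (k * d.-1 + 1)) k ^+ nleaves S <=
  sups (fun k => max_density R d (append_tree S D) (k * d.-1 + 1)) k.
Proof.
move=> d_ge2 dS; have [e eP] := nleaves_pad_append d S; exists e => k ck.
have m_gt0 := nleaves_gt0 S.
set a := fun k => max_density R d (append_tree S D) _.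
have ub_a : has_ubound (sdrop a k).
  by exists 1 => _ [j _ <-]; exact: max_density_le1.
have sup_a_ge0 : 0 <= sups a k.
  apply: (@le_trans _ _ (a k)); first exact: max_density_ge0.
  by apply: ub_le_sup => //; exists k => /=.
(* Two suprema are removed in turn: over the tail [j >= k], then over the trees inside
   [max_density]. *)
apply: exp_sup_le => //.
  by exists 1 => _ [j _ <-]; exact: max_density_le1.
move=> _ [j /= kj <-]; apply: exp_sup_le => //.
  by exists 1; exact: ubound_density.
move=> _ [T /= [dT nT] <-].
(* Since [d.-1 >= 1], [T] has [j * d.-1 + 1 > k] leaves. *)
apply: le_trans (density_pad_append _ dS (eP T) _ ck) _; first by rewrite nT; nia.
have dU := strictly_d_ary_pad_append dS dT.
apply: le_trans (density_le_max R (append_tree S D) dU) _.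
have [q nU] := nleaves_strictly_d_ary (ltnW d_ge2) dU.
rewrite nU; apply: ub_le_sup => //; exists q => //=.
(* Padding and appending do not decrease the number of leaves, so [q >= j >= k] and the padded tree
   lies in the same tail. *)
move: nU; rewrite eP nT; nia.
Qed.

Theorem theorem9 (R : realType) (d : nat) (S1 S2 : tree)
    (d_ge2 : (2 <= d)%N) (S1_d_ary : d_ary d S1) (S2_d_ary : d_ary d S2) :
  inducibility R d (append_tree S1 S2) >=
    ((nleaves S1 * nleaves S2)`!)%:R
      / (((nleaves S2)`!)%:R ^+ nleaves S1
         * (nleaves S1)%:R ^+ (nleaves S1 * nleaves S2))
      * inducibility R d S2 ^+ nleaves S1.
Proof.
have [e leS] := @sups_max_density_append_tree R d S1 S2 d_ge2 S1_d_ary.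
set C := _ / _ in leS *; set c := (nleaves S1 * nleaves S2 + e)%N in leS.
have x_cvg : (fun k : nat => 1 - c%:R * k.+1%:R^-1 : R) @ \oo --> (1 : R).
  rewrite -[X in _ --> X]subr0; apply: cvgB; first exact: cvg_cst.
  by rewrite -(mulr0 c%:R); apply: cvgMr; exact: cvg_harmonic.
have expr_cvg n (u : nat -> R) (l : R) :
    u @ \oo --> l -> (fun k => u k ^+ n) @ \oo --> (l ^+ n : R).
  move=> ul; apply: (cvg_comp u (fun x => x ^+ n) ul); exact: exprn_continuous.
(* The factor [1 ^+ _] is the limit of the error factor. *)
rewrite -[C]mulr1 -(expr1n R (nleaves S1 * nleaves S2)).
have lhs_cvg : C * (1 - c%:R / k.+1%:R) ^+ (nleaves S1 * nleaves S2) *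
    sups (fun k => max_density R d S2 (k * d.-1 + 1)) k ^+ nleaves S1 @[k --> \oo]
    --> C * 1 ^+ (nleaves S1 * nleaves S2) * inducibility R d S2 ^+ nleaves S1.
  apply: cvgM; last by apply: expr_cvg; exact: cvg_sups_max_density.
  by apply: cvgMr; apply: expr_cvg.
apply: (ler_cvg_to lhs_cvg (@cvg_sups_max_density R d (append_tree S1 S2))).
by exists c => // k; exact: leS.
Qed.
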